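(* If $G\subset\mathbb{R}$ is an additive subgroup of $\mathbb{R}$ that is a Borel set but not an $F_\sigma$ set, then $G$ is immeasurable.
   Context: A Borel measure on $\mathbb{R}$ is a (countably additive, $[0,\infty]$-valued) measure $\mu$ defined on a $\sigma$-algebra $\mathcal{S}$ of subsets of $\mathbb{R}$ containing all Borel sets ($\mathcal S$ may be larger than the Borel $\sigma$-algebra, and $\mu$ is not assumed to be $\sigma$-finite on $\mathbb{R}$). It is translation invariant if $S+t\in\mathcal{S}$ and $\mu(S+t)=\mu(S)$ for all $S\in\mathcal{S}$, $t\in\mathbb{R}$. A Borel set $B$ is $\sigma$-finite for $\mu$ if it is a countable union of sets in $\mathcal{S}$ of finite $\mu$-measure. A nonempty Borel set $B\subset\mathbb{R}$ is called immeasurable if for every translation invariant Borel measure $\mu$ on $\mathbb{R}$, either $\mu(B)=0$ or $B$ is not $\sigma$-finite for $\mu$. *)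

(* Defs.v *)
From HB Require Import structures.
From mathcomp Require Import all_boot all_order all_algebra.
From mathcomp Require Import all_classical all_reals all_analysis.
From mathcomp Require Import measurable_realfun borel_hierarchy.

Set Implicit Arguments.
Unset Strict Implicit.
Unset Printing Implicit Defensive.

Import Order.TTheory GRing.Theory Num.Theory.
Import numFieldNormedType.Exports.

Local Open Scope classical_set_scope.
Local Open Scope ring_scope.

(* The Borel sigma-algebra of the real line. MathComp-Analysis generates it
   from the intervals ]a, b]; see borelE for its description by open sets. *)
Definition borel {R : realType} : set (set R) :=
  @measurable _ (measurableTypeR R).

Lemma borelE (R : realType) : @borel R = <<s [set U : set R | open U] >>.
Proof.
rewrite /borel (@RGenOpens.measurableE R); apply/seteqP; split.
- apply: smallest_sub; first exact: smallest_sigma_algebra.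
  move=> A [a [b ->]]; apply: sub_sigma_algebra; exact: interval_open.
- rewrite -(@RGenOpens.measurableE R).
  apply: smallest_sub; first exact: (@sigma_algebra_measurable _ (measurableTypeR R)).
  by move=> U oU; exact: open_measurable.
Qed.

Definition translate (R : realType) (A : set R) (t : R) : set R :=
  [set x + t | x in A].

(* A measure on a sigma-algebra S of subsets of R is a measure on
   g_sigma_algebraType S, whose measurable sets are those of <<s S >> = S;
   its values outside S are junk and play no role. *)
Definition translation_invariant (R : realType) (S : set (set R))
    (mu : {measure set (g_sigma_algebraType S) -> \bar R}) : Prop :=
  forall (A : set R) (t : R), S A ->
    S (translate A t) /\ mu (translate A t) = mu A.

Definition immeasurable (R : realType) (B : set R) : Prop :=
  [/\ B !=set0, borel B &
      forall (S : set (set R))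
             (mu : {measure set (g_sigma_algebraType S) -> \bar R}),
        sigma_algebra [set: R] S -> borel `<=` S ->
        translation_invariant mu ->
        mu B = 0%E \/ ~ @sigma_finite _ (g_sigma_algebraType S) R B mu].

(* Main.v *)
(* Suppose mu is translation invariant, mu G <> 0 and G is a countable union of
   sets F n of finite measure. Some restriction of mu to F n is a nonzero finite
   Borel measure carried by G, so by regularity G contains a compact set K with
   mu K > 0. Pairwise disjoint translates g + K with g in G all have the same
   positive measure, so by sigma-finiteness there are only countably many of
   them; for a maximal such family, the compact sets g + (K - K) cover G, and
   G is an F_sigma set. *)
Require Import Defs.
From mathcomp Require Import all_boot all_order all_algebra.
From mathcomp Require Import all_classical all_reals all_analysis.
From mathcomp Require Import measurable_realfun borel_hierarchy.

Import Order.TTheory GRing.Theory Num.Theory.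
Import numFieldNormedType.Exports.

Local Open Scope classical_set_scope.
Local Open Scope ring_scope.

(** * Regularity of finite Borel measures on the line *)

Lemma nonincreasing_mu_lt d (T : measurableType d) (R : realType)
    (mu : {measure set T -> \bar R}) (F : (set T)^nat) (e : \bar R) :
  (mu (F 0%N) < +oo)%E -> (forall n, measurable (F n)) ->
  {homo F : n m / (n <= m)%N >-> m `<=` n} ->
  (mu (\bigcap_n F n) < e)%E -> exists n, (mu (F n) < e)%E.
Proof.
move=> F0 mF dF mue.
have cvF : mu (F n) @[n --> \oo] --> mu (\bigcap_n F n).
  apply: nonincreasing_cvg_mu => //; first exact: bigcapT_measurable.
  by move=> n m nm; apply/subsetPset/dF.
have /cvF [N _ FN] : nbhs (mu (\bigcap_n F n)) [set x | (x < e)%E].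
  by apply: open_nbhs_nbhs; split => //; exact: open_ereal_lt_ereal.
by exists N; apply: (FN N) => /=.
Qed.

(** Bounding [nu] of the gap [U \ C], with inner and outer sets taken together, makes the property
    symmetric under complementation, as an induction over a sigma-algebra requires. *)
Definition regular_approx (R : realType)
    (nu : {measure set (measurableTypeR R) -> \bar R}) (A : set R) :=
  forall e : R, 0 < e -> exists C U : set R,
    [/\ closed C, open U, C `<=` A, A `<=` U & (nu (U `\` C) < e%:E)%E].

Section regularity.
Context (R : realType) (nu : {measure set (measurableTypeR R) -> \bar R}).
Hypothesis nu_fin : (nu [set: R] < +oo)%E.

Let closed_borel (C : set R) : closed C ->
  measurable (C : set (measurableTypeR R)).
Proof. exact: closed_measurable. Qed.

Let open_borel (U : set R) : open U ->
  measurable (U : set (measurableTypeR R)).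
Proof. exact: open_measurable. Qed.

Let nuT (A : set R) : measurable (A : set (measurableTypeR R)) ->
  (nu A < +oo)%E.
Proof.
by move=> mA; apply: le_lt_trans nu_fin; apply: le_measure; rewrite ?inE.
Qed.

(** The ray is its own closed inner set and the decreasing intersection of the open rays [U n], so
    continuity from above makes the gap small. *)
Lemma regular_approx_ray (x : R) : regular_approx R nu `[x, +oo[%classic.
Proof.
move=> e e0; pose U n : set R := `]x - n.+1%:R^-1, +oo[%classic.
have oU n : open (U n) by exact: interval_open.
have cC : closed (`[x, +oo[%classic : set R) by exact: interval_closed.
have CE : `[x, +oo[%classic = \bigcap_n U n by exact: itvcyEbigcap.
have [||||n Un] := @nonincreasing_mu_lt _ _ _ nu
    (fun n => U n `\` `[x, +oo[%classic) e%:E.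
- by apply: nuT; apply: measurableD; [exact: open_borel|exact: closed_borel].
- by move=> n; apply: measurableD; [exact: open_borel|exact: closed_borel].
- move=> n m nm; apply: setSD => y; rewrite /U /= !in_itv /= !andbT.
  apply: le_lt_trans; rewrite lerD2l lerN2 lef_pV2 ?posrE ?ltr0n//.
  by rewrite ler_nat.
- rewrite (_ : \bigcap_n _ = set0) ?measure0 ?lte_fin//.
  apply/seteqP; split=> // y Uy; have [_] := Uy 0%N I; apply.
  suff : (\bigcap_n U n) y by rewrite -CE.
  by move=> n _; have [] := Uy n I.
exists `[x, +oo[%classic, (U n); split => //.
by rewrite CE; exact: bigcap_inf.
Qed.

Lemma regular_approxC (A : set R) :
  regular_approx R nu A -> regular_approx R nu (~` A).
Proof.
move=> rA e /rA[C [U [cC oU CA AU nuUC]]]; exists (~` U), (~` C).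
split; [exact: open_closedC|exact: closed_openC|exact: subsetC|exact: subsetC|].
by rewrite setDE setCK setIC -setDE.
Qed.

(** All the outer sets may be united, but only finitely many inner ones if the union is to stay
    closed; continuity from above, where [nu_fin] enters, pays for the truncation. *)
Lemma regular_approx_bigcup (A : (set R)^nat) :
  (forall n, regular_approx R nu (A n)) -> regular_approx R nu (\bigcup_n A n).
Proof.
move=> rA e e0.
(* The gaps sum to at most [e / 2]; the extra half makes the final bound strict. *)
have e20 n : 0 < e / 2 / (2 ^ n.+1)%:R by rewrite !divr_gt0 ?ltr0n ?expn_gt0.
have /choice[C /choice[U CU]] n := rA n _ (e20 n).
have cC n : closed (C n) by have [] := CU n.
have oU n : open (U n) by have [] := CU n.
have mC n := closed_borel _ (cC n).
have mU n := open_borel _ (oU n).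
pose V := \bigcup_n U n.
have oV : open V by apply: bigcup_open => n _.
pose B n := \bigcup_(i < n) C i.
have cB n : closed (B n).
  by apply: closed_bigcup; [exact: finite_II|move=> i _; exact: cC].
have [||||n Bn] := @nonincreasing_mu_lt _ _ _ nu (fun n => V `\` B n) e%:E.
- by apply: nuT; apply: measurableD; [exact: open_borel|exact: closed_borel].
- by move=> n; apply: measurableD; [exact: open_borel|exact: closed_borel].
- move=> n m nm; apply: setDS; apply: bigcup_subset => i /= im.
  exact: leq_trans im nm.
- rewrite bigcupDr // (_ : \bigcup_n B n = \bigcup_n C n); last first.
    apply/seteqP; split=> [x [n _ [i _ Cx]]|x [i _ Cx]]; first by exists i.
    by exists i.+1 => //; exists i => /=.
  apply: (@le_lt_trans _ _ (e / 2)%:E); last first.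
    by rewrite lte_fin ltr_pdivrMr// ltr_pMr// ltr1n.
  apply: le_trans (epsilon_trick0 xpredT (ltW (divr_gt0 e0 (ltr0n _ 2)))).
  apply: (@le_trans _ _ (\sum_(0 <= n <oo) nu (U n `\` C n))%E).
    apply: measure_sigma_subadditive.
    + by move=> n; exact: measurableD.
    + by apply: measurableD; exact: bigcupT_measurable.
    + move=> x [[n _ Ux] nC]; exists n => //; split => // Cx.
      by apply: nC; exists n.
  apply: lee_nneseries => [n _ _|n _]; first exact: measure_ge0.
  by have [_ _ _ _ /ltW] := CU n.
exists (B n), V; split => //.
- by move=> x [i _ Cx]; exists i => //; have [_ _ + _ _] := CU i; exact.
- by move=> x [i _ Ax]; exists i => //; have [_ _ _ + _] := CU i; exact.
Qed.

(** The regular sets form a sigma-algebra containing the closed rays, which generate the Borel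
    sets. *)
Lemma finite_borel_regular (A : set R) : borel A -> regular_approx R nu A.
Proof.
rewrite /borel RGenCInfty.measurableE; apply: smallest_sub; last first.
  by move=> _ [x ->]; exact: regular_approx_ray.
split.
- by move=> e e0; exists set0, set0; split; rewrite ?setDv ?measure0 ?lte_fin//;
    exact: closed0.
- by move=> B rB; rewrite setTD; exact: regular_approxC.
- exact: regular_approx_bigcup.
Qed.

Lemma compact_posmeasure (A : set R) : borel A -> (0 < nu A)%E ->
  exists K : set R, [/\ compact K, K `<=` A & (0 < nu K)%E].
Proof.
move=> mA A0.
have fA : nu A \is a fin_num by rewrite ge0_fin_numE ?measure_ge0// nuT.
(* The tolerance is [nu A] itself: if [C] were null, then [nu A <= nu (U \ C) < nu A]. *)
have e0 : 0 < fine (nu A) by rewrite fine_gt0// A0 nuT.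
have [C [U [cC oU CA AU UC]]] := finite_borel_regular A mA _ e0.
have mC := closed_borel _ cC.
have C0 : (0 < nu C)%E.
  rewrite lt0e measure_ge0 andbT; apply/negP => /eqP nuC0.
  move: UC; rewrite fineK// ltNge => /negP; apply.
  rewrite (measureDI nu mA mC) (setIidr CA) [X in (_ + X)%E]nuC0 adde0.
  apply: le_measure; rewrite ?inE; [exact: measurableD| |exact: setSD].
  by apply: measurableD => //; exact: open_borel.
(* The closed set [C] is exhausted by countably many compact pieces, which cannot all be null. *)
pose K n : set R := C `&` `[- n%:R, n%:R]%classic.
have cK n : compact (K n).
  apply: (subclosed_compact _ (@segment_compact _ (- n%:R) n%:R)).
    by apply: closedI => //; exact: interval_closed.
  exact: subIsetr.
have CK : C = \bigcup_n K n.
  rewrite -setI_bigcupr (_ : \bigcup_n _ = setT) ?setIT//.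
  apply/seteqP; split=> // x _; exists (Num.bound `|x|) => //=.
  by rewrite in_itv /= -ler_norml ltW// archi_boundP.
have mK n := closed_borel _ (compact_closed (@Rhausdorff R) (cK n)).
have [n Kn] : exists n, (0 < nu (K n))%E.
  apply/not_existsP => K0; move: C0; rewrite ltNge => /negP; apply.
  rewrite le_eqVlt; apply/orP; left; apply/eqP.
  apply: measure_negligible => //; rewrite CK.
  apply: negligible_bigcup => n; apply/negligibleP => //.
  by apply/eqP; rewrite eq_le measure_ge0 andbT leNgt; exact/negP/K0.
by exists (K n); split => //; apply: subset_trans CA; exact: subIsetl.
Qed.

End regularity.

(** * Countability of disjoint families and countable unions of closed sets *)

Lemma countable_disjoint_posmeasure d (T : measurableType d) (R : realType)
    (I : pointedType) (mu : {measure set T -> \bar R}) (E : set T)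
    (D : set I) (B : I -> set T) :
  measurable E -> (mu E < +oo)%E -> (forall i, measurable (B i)) ->
  trivIset D B -> countable [set i | D i /\ (0 < mu (E `&` B i))%E].
Proof.
move=> mE Eoo mB tB.
have mEB i : measurable (E `&` B i) by exact: measurableI.
have fEB i : mu (E `&` B i) \is a fin_num.
  rewrite ge0_fin_numE ?measure_ge0//; apply: le_lt_trans Eoo.
  by apply: le_measure; rewrite ?inE//; exact: subIsetl.
rewrite [X in countable X](_ : _ = \bigcup_n
    [set i | D i /\ (n.+1%:R^-1%:E < mu (E `&` B i))%E]); last first.
  apply/seteqP; split=> [i [Di]|i [n _ [Di]]] /=.
    rewrite -(fineK (fEB i)) lte_fin => /ltr_add_invr[n]; rewrite add0r => ni.
    by exists n => //; split => //; rewrite -(fineK (fEB i)) lte_fin.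
  by move=> ni; split => //; apply: lt_trans ni; rewrite lte_fin.
(* For each [n] the index set is finite: an injective sequence [q] in it would give disjoint parts
   of [E], each of measure above [1/(n+1)]. *)
apply: bigcup_countable => // n _; apply: finite_set_countable.
apply: contrapT => /infiniteP/pcard_leP/injfunPex[/= q qD qI].
have tq : trivIset setT (fun k => E `&` B (q k)).
  apply: trivIset_setIl.
  rewrite (trivIset_comp B)//; apply: sub_trivIset tB.
  by move=> _ [k _ <-]; have [] := qD k Logic.I.
have mUq : measurable (\bigcup_k (E `&` B (q k))).
  exact: bigcupT_measurable.
have : (mu (\bigcup_k (E `&` B (q k))) <= mu E)%E.
  apply: le_measure; rewrite ?inE//.
  by apply: bigcup_sub => k _; exact: subIsetl.
apply/negP; rewrite -ltNge measure_bigcup//.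
(* Chosen so that [N / (n+1)] already exceeds [mu E]. *)
pose N := (Num.bound (fine (mu E)) * n.+1)%N.
have Efin : mu E \is a fin_num by rewrite ge0_fin_numE ?measure_ge0.
apply: (@lt_le_trans _ _ (\sum_(0 <= k < N) n.+1%:R^-1%:E)%E).
  rewrite sumEFin sumr_const_nat subn0 -[X in X%:E]mulr_natr natrM mulrCA.
  by rewrite mulVf// mulr1 -(fineK Efin) lte_fin archi_boundP// fine_ge0.
apply: le_trans (nneseries_lim_ge N _) => //.
under [leRHS]eq_bigl do rewrite in_setT.
by apply: lee_sum => k _; have [_ /ltW] := qD k Logic.I.
Qed.

Lemma countable_bigcup_Fsigma (T : topologicalType) (I : Type) (D : set I)
    (B : I -> set T) :
  countable D -> (forall i, closed (B i)) -> Fsigma (\bigcup_(i in D) B i).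
Proof.
move=> /countable_injP[f fI] cB.
(* Reindexing by the injection [f]: the [n]-th closed set is the only [B i] with [f i = n], or empty
   when [n] is not a value of [f] on [D]. *)
exists (fun n => \bigcup_(i in D `&` f @^-1` [set n]) B i) => [n|].
  have [[i [Di fi]]|/set0P/negP/negPn/eqP ->] :=
      pselect ((D `&` f @^-1` [set n]) !=set0); last first.
    by rewrite bigcup_set0; exact: closed0.
  rewrite (_ : _ `&` _ = [set i]) ?bigcup_set1//.
  apply/seteqP; split=> [j [Dj fj]|_ ->] //.
  by apply: fI; rewrite ?inE// fi.
apply/seteqP; split=> [x [i Di Bx]|x [n _ [i [Di _] Bx]]].
  by exists (f i) => //; exists i.
by exists i.
Qed.

(** * Translates of a compact subset of a subgroup *)

Lemma compact_translate_diff (R : realType) (K : set R) (g : R) :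
  compact K -> compact [set g + (p.1 - p.2) | p in K `*` K].
Proof.
move=> cK; apply: continuous_compact; last exact: compact_setX.
apply: continuous_subspaceT => p.
by apply: cvgD; [exact: cvg_cst|apply: cvgB; [exact: cvg_fst|exact: cvg_snd]].
Qed.

Lemma zmod_closed_add (V : zmodType) (G : set V) (x y : V) :
  zmod_closed (mem G) -> G x -> G y -> G (x + y).
Proof.
move=> /GRing.zmod_closedD[_ GD] Gx Gy.
by apply/set_mem/GD; exact: mem_set.
Qed.

(* By maximality of D, each translate h + K with h in G meets some g + K with
   g in D, so h lies in g + (K - K). *)
Lemma subgroup_cover (R : realType) (G K D : set R) :
  zmod_closed (mem G) -> K `<=` G -> K !=set0 ->
  maximal_disjoint_subcollection (translate K) D G ->
  G = \bigcup_(g in D) [set g + (p.1 - p.2) | p in K `*` K].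
Proof.
move=> Gz KG [k0 Kk0] [DG tD maxD].
have GBs x y : G x -> G y -> G (x - y).
  by move=> Gx Gy; apply/set_mem/(proj2 Gz); exact: mem_set.
apply/seteqP; split=> [h Gh|_ [g Dg [[x y] [/= Kx Ky] <-]]]; last first.
  by apply: zmod_closed_add => //; [exact: DG|apply: GBs; exact: KG].
have [Dh|nDh] := pselect (D h).
  by exists h => //; exists (k0, k0) => //=; rewrite subrr addr0.
apply: contrapT => nh; apply: (maxD (h |` D)).
- by split; [exact: subsetUr|move=> hD; apply/nDh/hD; left].
- by move=> x [->|/DG].
have disj g : D g -> translate K h `&` translate K g = set0.
  move=> Dg; apply/seteqP; split=> // _ [[x Kx <-] [y Ky /= yx]]; apply: nh.
  exists g => //; exists (y, x) => //=.
  by rewrite addrA [g + y]addrC yx addrAC subrr add0r.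
apply/trivIsetP => i j [->|Di] [->|Dj]; rewrite ?eqxx// => ij.
- exact: disj.
- by rewrite setIC; exact: disj.
- by move/trivIsetP : tD; exact.
Qed.

(** Used with the identity map to carry the restriction of [mu] to one [F n] from the possibly
    larger [S] down to the Borel sets, where it is finite and regularity applies. *)
Lemma pushforward_mrestr d d' (T : measurableType d) (T' : measurableType d')
    (R : realType) (mu : {measure set T -> \bar R}) (E : set T) (f : T -> T') :
  measurable E -> measurable_fun [set: T] f ->
  exists nu : {measure set T' -> \bar R},
    forall A, nu A = mu (f @^-1` A `&` E).
Proof.
move=> mE mf; unshelve eexists.
  refine [the {measure set T' -> \bar R} of pushforward (mrestr mu mE) f].
  exact: mf.
by [].
Qed.

Theorem theorem2p10 (R : realType) (G : set R)
    (G_subgroup : zmod_closed (mem G)) (G_borel : borel G)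
    (G_not_Fsigma : ~ Fsigma G) :
  immeasurable G.
Proof.
split => [||S mu _ borelS mu_transl] //.
  by exists 0; apply/set_mem; have [] := G_subgroup.
have [muG|muG] := eqVneq (mu G) 0%E; [by left|right => -[F GF mF]].
have SE (A : set R) :
    S A -> measurable (A : set (g_sigma_algebraType S)).
  exact: sub_sigma_algebra.
have [n Fn0] : exists n, mu (F n) <> 0%E.
  apply: contrapT => /forallNP F0; move/eqP : muG; apply.
  apply: measure_negligible; first exact: (SE _ (borelS _ G_borel)).
  rewrite GF; apply: negligible_bigcup => n; apply/negligibleP.
    by have [] := mF n.
  by apply: contrapT; exact: F0.
have [mFn Fnoo] := mF n.
(* Measurability of the identity amounts to the inclusion of the Borel sets in [S]. *)
have mid : measurable_fun [set: g_sigma_algebraType S]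
    (idfun : g_sigma_algebraType S -> measurableTypeR R).
  by move=> _ A mA; rewrite setTI; exact: (SE _ (borelS _ mA)).
have [nu nuE] := pushforward_mrestr _ _ _ _ _ mu _ _ mFn mid.
have [|||K [cK KG nuK]] := @compact_posmeasure R nu _ G => //.
- by rewrite nuE setTI.
- rewrite nuE setIidr; last by rewrite GF; exact: bigcup_sup.
  by rewrite lt0e measure_ge0 andbT; exact/eqP.
have SK : S K.
  have clK : closed K by apply: compact_closed => //; exact: Rhausdorff.
  by apply: borelS; exact: closed_measurable.
have muK : (0 < mu K)%E.
  apply: lt_le_trans nuK _; rewrite nuE; apply: le_measure; rewrite ?inE.
  - by apply: measurableI => //; exact: SE.
  - exact: SE.
  - exact: subIsetl.
have K0 : K !=set0.
  by apply/set0P/eqP => K0; move: muK; rewrite K0 measure0 ltxx.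
have [D maxD] := ex_maximal_disjoint_subcollection (translate K) G.
(* The cover consists of compact, hence closed, sets; what remains is that [D] is countable. *)
apply: G_not_Fsigma; rewrite (subgroup_cover _ _ _ _ G_subgroup KG K0 maxD).
apply: countable_bigcup_Fsigma => [|g]; last first.
  exact: compact_closed (@Rhausdorff R) (compact_translate_diff _ _ _ cK).
have [DG tD _] := maxD.
have mKg g : measurable (translate K g : set (g_sigma_algebraType S)).
  by apply: SE; have [] := mu_transl K g SK.
have mF1 i : measurable (F i) by have [] := mF i.
(* Each translate [g + K] with [g] in [D] has positive measure and lies in [G], the union of the
   [F i], so it meets some [F i] in positive measure; each [F i] allows only countably many such
   [g]. *)
apply: (@sub_countable _ _ _ (\bigcup_i
    [set g | D g /\ (0 < mu (F i `&` translate K g))%E])); last first.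
  apply: bigcup_countable => // i _.
  by apply: countable_disjoint_posmeasure => //; have [] := mF i.
apply: subset_card_le => g Dg; apply: contrapT => ng.
move: muK; have [_ <-] := mu_transl K g SK; rewrite ltNge => /negP; apply.
rewrite le_eqVlt; apply/orP; left; apply/eqP.
apply: measure_negligible => //.
rewrite (_ : translate K g = \bigcup_i (F i `&` translate K g)).
  apply: negligible_bigcup => i; apply/negligibleP; first exact: measurableI.
  apply/eqP; rewrite eq_le measure_ge0 andbT leNgt; apply/negP => Fi.
  by apply: ng; exists i.
rewrite -setI_bigcupl -GF setIidr// => _ [x Kx <-].
by apply: zmod_closed_add => //; [exact: KG|exact: DG].
Qed.
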